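(* For any topological space $X$, $F_q(X)$ is a quasitopological group. Moreover, the inclusion of generators $\sigma:X\to F_q(X)$, $\sigma(x)=x$, is continuous and universal in the sense that for any continuous function $f:X\to G$ to a quasitopological group $G$ there is a unique continuous group homomorphism $\widehat{f}:F_q(X)\to G$ such that $\widehat{f}\circ\sigma=f$.
   Context: A quasitopological group is a group $G$ with a topology such that inversion $g\mapsto g^{-1}$ is continuous and the operation $G\times G\to G$ is continuous in each variable separately. Cross product: for topological spaces $X_1,X_2$, $X_1\otimes X_2$ is the set $X_1\times X_2$ with the topology in which $U$ is open iff $\{x\in X_1 : (x,y)\in U\}$ is open in $X_1$ for every $y\in X_2$ and $\{y\in X_2:(x,y)\in U\}$ is open in $X_2$ for every $x\in X_1$. $X^{\otimes n}$ is the $n$-fold iterated cross product of $X$ with itself (equivalently, $X^n$ with a set open iff each of its slices obtained by fixing all but one coordinate is open in $X$); $X^{\otimes 0}=\{e\}$ is a one-point space. For a space $Z$, $M_{st}(Z)=\coprod_{n\ge 0}Z^{\otimes n}$ (topological sum); its elements are written as words $z_1z_2\cdots z_n$, and it is a monoid under concatenation with identity the empty word $e$. For a space $X$, $X^{-1}$ is a homeomorphic copy of $X$ with elements written $x^{-1}$, and $X\sqcup X^{-1}$ is the topological sum. $F(X)$ is the free group on the set $X$, realized as the set of reduced words in $X\sqcup X^{-1}$ with operation concatenation followed by reduction, and $R:M_{st}(X\sqcup X^{-1})\to F(X)$ sends each word to its reduced form. By definition, $F_q(X)$ is the group $F(X)$ with the quotient topology induced by $R$. *)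

(* Defs.v *)
From HB Require Import structures.
From mathcomp Require Import all_boot.
From mathcomp Require Import all_classical.
From mathcomp Require Import topology_structure discrete_topology sigT_topology.
From mathcomp Require Import quotient_topology.

Set Implicit Arguments.
Unset Strict Implicit.
Unset Printing Implicit Defensive.

Local Open Scope classical_set_scope.
Local Open Scope group_scope.

#[short(type="preTopologicalGroupType")]
HB.structure Definition PreTopologicalGroup :=
  {G of Topological G & Group G}.

Definition quasitopological_group (G : preTopologicalGroupType) : Prop :=
  [/\ continuous (fun x : G => x^-1),
      forall a : G, continuous (fun x : G => a * x)
    & forall a : G, continuous (fun x : G => x * a)].

Definition cross (X1 X2 : Type) : Type := (X1 * X2)%type.

Section Cross.
Context {X1 X2 : topologicalType}.

HB.instance Definition _ := Choice.copy (cross X1 X2) (X1 * X2)%type.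

Definition cross_open (U : set (cross X1 X2)) : Prop :=
  (forall y : X2, open [set x : X1 | U (x, y)]) /\
  (forall x : X1, open [set y : X2 | U (x, y)]).

Lemma cross_openT : cross_open setT.
Proof. by split=> z; exact: (@openT). Qed.

Lemma cross_openI : setI_closed cross_open.
Proof.
move=> A B [A1 A2] [B1 B2].
by split=> z; [exact: openI (A1 z) (B1 z) | exact: openI (A2 z) (B2 z)].
Qed.

Lemma cross_open_bigU (I : Type) (f : I -> set (cross X1 X2)) :
  (forall i, cross_open (f i)) -> cross_open (\bigcup_i f i).
Proof.
move=> fo; split=> z.
  rewrite (_ : mkset _ = \bigcup_i [set x | f i (x, z)]) //.
  by apply: bigcup_open => i _; case: (fo i).
rewrite (_ : mkset _ = \bigcup_i [set y | f i (z, y)]) //.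
by apply: bigcup_open => i _; case: (fo i).
Qed.

HB.instance Definition _ := isOpenTopological.Build (cross X1 X2)
  cross_openT cross_openI cross_open_bigU.

Lemma cross_openE (U : set (cross X1 X2)) : open U = cross_open U.
Proof. by []. Qed.

End Cross.

Fixpoint cross_pow (Z : topologicalType) (n : nat) : topologicalType :=
  if n is m.+1 then cross Z (cross_pow Z m) else discrete_topology unit.

Lemma cross_pow_openE (Z : topologicalType) (n : nat)
    (U : set (cross_pow Z n.+1)) :
  open U = cross_open (U : set (cross Z (cross_pow Z n))).
Proof. by []. Qed.

(* The topological sum, with the library's topology on sigma types. *)
Definition Mst (Z : topologicalType) : topologicalType :=
  {n : nat & cross_pow Z n}.

Lemma Mst_openP (Z : topologicalType) (U : set (Mst Z)) :
  open U <-> forall n, open [set w : cross_pow Z n | U (existT _ n w)].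
Proof.
split=> [oU n|oU].
  by move/continuousP: (@existT_continuous nat (cross_pow Z) n); apply.
rewrite openE => -[n w] Uw.
exact: (open_nbhs_nbhs (conj (oU n) Uw)).
Qed.

Section Words.
Context {Z : topologicalType}.

Fixpoint seq_of_pow (n : nat) : cross_pow Z n -> seq Z :=
  match n with
  | 0 => fun _ => [::]
  | m.+1 => fun z => z.1 :: seq_of_pow z.2
  end.

Definition seq_of_word (w : Mst Z) : seq Z := seq_of_pow (projT2 w).

Fixpoint pow_of_seq (s : seq Z) : cross_pow Z (size s) :=
  match s with
  | [::] => tt
  | z :: s' => (z, pow_of_seq s')
  end.

Definition word_of_seq (s : seq Z) : Mst Z := existT _ (size s) (pow_of_seq s).

Lemma word_of_seqK : cancel word_of_seq seq_of_word.
Proof. by rewrite /seq_of_word; elim=> //= z s ->. Qed.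

Lemma seq_of_wordK : cancel seq_of_word word_of_seq.
Proof.
case=> n; rewrite /seq_of_word /word_of_seq /=.
elim: n => [[]//|n IHn] [z w] /=.
pose scons (p : Mst Z) : Mst Z :=
  existT _ (projT1 p).+1 ((z, projT2 p) : cross_pow Z (projT1 p).+1).
exact: (congr1 scons (IHn w)).
Qed.

End Words.

(* The disjoint union of [X] and [X^-1]: [(true, x)] encodes the letter [x] *)
(* and [(false, x)] the letter [x^-1].                                      *)
Definition letter (X : topologicalType) : topologicalType := {_ : bool & X}.

Lemma letter_openP (X : topologicalType) (U : set (letter X)) :
  open U <-> forall b, open [set x : X | U (existT _ b x)].
Proof.
split=> [oU b|oU].
  by move/continuousP: (@existT_continuous bool (fun=> X) b); apply.
rewrite openE => -[b x] Ux.
exact: (open_nbhs_nbhs (conj (oU b) Ux)).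
Qed.

Section FreeGroup.
Context {X : topologicalType}.

Definition letter_inv (a : letter X) : letter X :=
  existT _ (~~ projT1 a) (projT2 a).

Definition reduced (s : seq (letter X)) : bool :=
  sorted (fun a b => b != letter_inv a) s.

(* [push a s] is the reduced form of [a :: s] when [s] is reduced. *)
Definition push (a : letter X) (s : seq (letter X)) : seq (letter X) :=
  if s is b :: s' then if b == letter_inv a then s' else a :: s else [:: a].

Definition reduce (s : seq (letter X)) : seq (letter X) := foldr push [::] s.

Definition inv_seq (s : seq (letter X)) : seq (letter X) :=
  rev (map letter_inv s).

Lemma letter_invK : involutive letter_inv.
Proof. by case=> b x; rewrite /letter_inv /= negbK. Qed.

Lemma reduced_behead a s : reduced (a :: s) -> reduced s.
Proof. exact: path_sorted. Qed.

Lemma push_reduced a s : reduced s -> reduced (push a s).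
Proof.
case: s => [|b s] //= rbs; case: ifP => [_|/negbT ab]; first exact: path_sorted rbs.
by rewrite /reduced /= ab.
Qed.

Lemma pushK a s : reduced s -> push (letter_inv a) (push a s) = s.
Proof.
case: s => [|b s] /=; first by rewrite letter_invK eqxx.
case: eqP => [-> |_] /=; last by rewrite letter_invK eqxx.
by case: s => [|c s] //= /andP[/negbTE ->].
Qed.

Lemma pushVK a s : reduced s -> push a (push (letter_inv a) s) = s.
Proof. by move=> /(pushK (letter_inv a)); rewrite letter_invK. Qed.

Lemma foldr_push_reduced s t : reduced t -> reduced (foldr push t s).
Proof. by move=> rt; elim: s => //= a s; exact: push_reduced. Qed.

Lemma reduce_reduced s : reduced (reduce s).
Proof. exact: foldr_push_reduced. Qed.

Lemma reduce_id s : reduced s -> reduce s = s.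
Proof.
elim: s => //= a s IHs ras; rewrite IHs ?(reduced_behead ras) //.
by case: s ras {IHs} => [|b s] //= /andP[/negbTE ->].
Qed.

Lemma foldr_push_push a s t :
  reduced t -> foldr push t (push a s) = push a (foldr push t s).
Proof.
move=> rt; case: s => [|b s] //=; case: eqP => [->|//].
by rewrite pushVK ?foldr_push_reduced.
Qed.

Lemma foldr_push_reduce s t :
  reduced t -> foldr push t (reduce s) = foldr push t s.
Proof. by move=> rt; elim: s => //= a s IHs; rewrite foldr_push_push // IHs. Qed.

Lemma reduce_cat s t : reduce (s ++ t) = foldr push (reduce t) s.
Proof. by rewrite /reduce foldr_cat. Qed.

Lemma reduce_reducel s t : reduce (reduce s ++ t) = reduce (s ++ t).
Proof. by rewrite !reduce_cat foldr_push_reduce ?reduce_reduced. Qed.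

Lemma reduce_reducer s t : reduce (s ++ reduce t) = reduce (s ++ t).
Proof. by rewrite !reduce_cat (reduce_id (reduce_reduced t)). Qed.

Lemma reduce_cancel s t a :
  reduce (s ++ [:: a, letter_inv a & t]) = reduce (s ++ t).
Proof. by rewrite !reduce_cat /= pushVK ?reduce_reduced. Qed.

Lemma inv_seqK : involutive inv_seq.
Proof. by move=> s; rewrite /inv_seq map_rev revK (mapK letter_invK). Qed.

Lemma inv_seq_reduced s : reduced s -> reduced (inv_seq s).
Proof.
rewrite /reduced /inv_seq rev_sorted sorted_map; apply: sub_sorted => a b /=.
by apply: contra => /eqP ->; rewrite letter_invK.
Qed.

Lemma reduce_inv_seql s : reduce (inv_seq s ++ s) = [::].
Proof.
elim: s => [|a s IHs] //.
rewrite /inv_seq map_cons rev_cons -cats1 -catA cat1s.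
by have := reduce_cancel (inv_seq s) s (letter_inv a); rewrite letter_invK => ->.
Qed.

Lemma reduce_inv_seqr s : reduce (s ++ inv_seq s) = [::].
Proof. by rewrite -{1}(inv_seqK s) reduce_inv_seql. Qed.

End FreeGroup.

Definition free_group (X : topologicalType) : Type :=
  {s : seq (letter X) | reduced s}.

Section FreeGroupStructure.
Context {X : topologicalType}.
Local Notation F := (free_group X).

HB.instance Definition _ := Choice.copy F {s : seq (letter X) | reduced s}.

Definition free_of_seq (s : seq (letter X)) : F :=
  exist _ (reduce s) (reduce_reduced s).

Definition free_one : F := free_of_seq [::].
Definition free_mul (u v : F) : F := free_of_seq (sval u ++ sval v).
Definition free_inv (u : F) : F :=
  exist _ (inv_seq (sval u)) (inv_seq_reduced (svalP u)).

Lemma free_mulA : associative free_mul.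
Proof.
move=> u v w; apply: val_inj => /=.
by rewrite reduce_reducel reduce_reducer catA.
Qed.

Lemma free_mul1 : left_id free_one free_mul.
Proof. by move=> u; apply: val_inj; exact: reduce_id (svalP u). Qed.

Lemma free_mulr1 : right_id free_one free_mul.
Proof.
by move=> u; apply: val_inj; rewrite /= cats0; exact: reduce_id (svalP u).
Qed.

Lemma free_mulV : left_inverse free_one free_inv free_mul.
Proof. by move=> u; apply: val_inj; exact: reduce_inv_seql. Qed.

Lemma free_mulrV : right_inverse free_one free_inv free_mul.
Proof. by move=> u; apply: val_inj; exact: reduce_inv_seqr. Qed.

Definition reduction (w : Mst (letter X)) : F := free_of_seq (seq_of_word w).

Definition free_repr (u : F) : Mst (letter X) := word_of_seq (sval u).

Lemma free_reprK : cancel free_repr reduction.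
Proof.
move=> u; apply: val_inj; rewrite /= word_of_seqK.
exact: reduce_id (svalP u).
Qed.

(* The library's [quotient_topology] acts on a [quotType]; here the canonical *)
(* surjection of that quotient is [reduction].                                *)
HB.instance Definition _ := isQuotient.Build (Mst (letter X)) F free_reprK.

End FreeGroupStructure.

Definition Fq (X : topologicalType) : Type := quotient_topology (free_group X).

Section Fq.
Context {X : topologicalType}.

HB.instance Definition _ :=
  Topological.copy (Fq X) (quotient_topology (free_group X)).
HB.instance Definition _ := isGroup.Build (Fq X)
  free_mulA free_mul1 free_mulr1 free_mulV free_mulrV.

Definition sigma (x : X) : Fq X := free_of_seq [:: existT _ true x].

Lemma Fq_openE (U : set (Fq X)) : open U = open (@reduction X @^-1` U).
Proof. by rewrite {1}/open /= /quotient_open /= unlock. Qed.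

Lemma sval_sigma x : sval (sigma x) = [:: existT _ true x].
Proof. by []. Qed.

Lemma Fq_mulE (u v : Fq X) : sval (u * v) = reduce (sval u ++ sval v).
Proof. by []. Qed.

End Fq.

(* Main.v *)
Require Import Defs.
From HB Require Import structures.
From mathcomp Require Import all_boot all_classical topology_structure.
From mathcomp Require Import discrete_topology.

(** The quotient map from words to reduced words, composed with the cross
topology on words, makes [Fq X] a space in which continuity is tested one letter
at a time: a map [h] out of [Fq X] is continuous iff, for all words [s], [t] and
each sign [b], the map [x |-> h (s x^b t)] from [X] is continuous
([Fq_continuousP]).  This is separate continuity in every letter of every word,
and both halves of the theorem are read off from it.

The maps [x |-> s x^b t] themselves are continuous, as the criterion for the
identity map shows.  Translations and inversion of [Fq X] turn such a map into
another one of the same kind: [a (s x^b t) = (a s) x^b t], similarly on the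
right, and [(s x^b t)^-1 = t^-1 x^-b s^-1].  So [Fq X] is a quasitopological
group, and [sigma] is the case where [s] and [t] are empty and [b] is positive.

For the universal property, the algebraic extension of [f : X -> G] evaluates a
word in [G]; cancelling pairs of letters have trivial value, so evaluation
ignores reduction and is a morphism ([word_value_reduce]).  On [s x^b t] it
takes the value [g (f x)^b g'] with [g], [g'] independent of [x], and this is
continuous in [x] because inversion and translations of [G] are: the criterion
asks for no more than the axioms of a quasitopological group provide
([extension_continuous]).  Uniqueness holds because [sigma] generates the
group. *)

Local Open Scope classical_set_scope.
Local Open Scope group_scope.

Lemma size_seq_of_pow (Z : topologicalType) (n : nat) (w : cross_pow Z n) :
  size (seq_of_pow w) = n.
Proof. by elim: n w => //= n IHn w; rewrite IHn. Qed.

(** By induction on the number of factors: a slice along the first coordinate is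
the case of an empty prefix, and a slice along a later one is, once the first
letter is fixed, a slice of the power with one factor fewer.  Sets of tuples are
given by predicates on sequences so that lengths need not be matched in types. *)
Lemma cross_pow_open_slices (Z : topologicalType) (n : nat)
    (P : set (seq Z)) :
  open [set w : cross_pow Z n | P (seq_of_pow w)] <->
  forall s t, n = (size s + size t).+1 -> open [set z | P (s ++ z :: t)].
Proof.
elim: n P => [|n IHn] P.
  (* there is no slice to test: the power with no factor is discrete *)
  split=> // _; rewrite openE => w Pw.
  rewrite /interior; rewrite (@nbhs_principalE (discrete_topology unit)).
  exact/principal_filterP.
rewrite cross_pow_openE; split.
- case=> oPl oPr [|a s] t [].
    rewrite /= => nt; subst n.
    have := oPl (pow_of_seq t).
    by rewrite /= (word_of_seqK t : seq_of_pow (pow_of_seq t) = t).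
  by move/(IHn [set u | P (a :: u)]): (oPr a); apply.
move=> oP; split=> [w|a] /=.
  by apply: (oP [::]); rewrite /= add0n size_seq_of_pow.
apply/(IHn [set u | P (a :: u)]) => s t nst.
by apply: (oP (a :: s)); rewrite nst.
Qed.

Lemma Fq_open_slices (X : topologicalType) (U : set (Fq X)) :
  open U <-> forall s t b,
    open [set x : X | U (free_of_seq (s ++ existT _ b x :: t))].
Proof.
rewrite Fq_openE Mst_openP; split=> [oU s t b|oU n].
  pose P : set (seq (letter X)) := [set u | U (free_of_seq u)].
  have /letter_openP := proj1 (cross_pow_open_slices _ _ P) (oU _) s t erefl.
  exact.
apply/(cross_pow_open_slices _ _ [set u | U (free_of_seq u)]) => s t _.
by apply/letter_openP => b; exact: oU.
Qed.

(** The criterion through which all continuity statements about [Fq X] go, both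
for [Fq X] as a source and, applied to the identity, as a target. *)
Lemma Fq_continuousP (X Y : topologicalType) (h : Fq X -> Y) :
  continuous h <-> forall s t b,
    continuous (fun x : X => h (free_of_seq (s ++ existT _ b x :: t))).
Proof.
split=> [/continuousP ch s t b|ch]; apply/continuousP => V oV.
  by move/Fq_open_slices: (ch V oV); apply.
by apply/Fq_open_slices => s t b; move/continuousP: (ch s t b); apply.
Qed.

Lemma free_of_seq_continuous (X : topologicalType) (s t : seq (letter X)) b :
  continuous (fun x : X => free_of_seq (s ++ existT _ b x :: t) : Fq X).
Proof.
have cid : continuous (id : Fq X -> Fq X) by move=> u; exact: cvg_id.
exact: (proj1 (Fq_continuousP X (Fq X) id) cid s t b).
Qed.

Lemma free_of_seq_cat (X : topologicalType) (s t : seq (letter X)) :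
  free_of_seq (s ++ t) = (free_of_seq s : Fq X) * free_of_seq t.
Proof. by apply: val_inj; rewrite /= reduce_reducel reduce_reducer. Qed.

Lemma free_of_seqK (X : topologicalType) (u : Fq X) : free_of_seq (sval u) = u.
Proof. by apply: val_inj; exact: reduce_id (svalP u). Qed.

Lemma free_of_seq_inv (X : topologicalType) (s : seq (letter X)) :
  free_of_seq (inv_seq s) = (free_of_seq s : Fq X)^-1.
Proof.
apply/esym/(@mulg1_eq (Fq X)); rewrite -free_of_seq_cat.
by apply: val_inj; exact: reduce_inv_seqr.
Qed.

(** Translations and inversion carry a word with one free letter to another
such word, up to reduction. *)
Lemma Fq_quasitopological (X : topologicalType) : quasitopological_group (Fq X).
Proof.
split=> [|a|a]; apply/Fq_continuousP => s t b.
- rewrite (_ : (fun x => _) = fun x => free_of_seq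
      (inv_seq t ++ existT _ (~~ b) x :: inv_seq s)).
    exact: free_of_seq_continuous.
  apply/funext => x; rewrite -free_of_seq_inv; congr free_of_seq.
  by rewrite /inv_seq map_cat rev_cat map_cons rev_cons cat_rcons.
- rewrite (_ : (fun x => _) = fun x => free_of_seq
      ((sval a ++ s) ++ existT _ b x :: t)).
    exact: free_of_seq_continuous.
  by apply/funext => x; rewrite -{1}[a]free_of_seqK -free_of_seq_cat catA.
- rewrite (_ : (fun x => _) = fun x => free_of_seq
      (s ++ existT _ b x :: (t ++ sval a))).
    exact: free_of_seq_continuous.
  by apply/funext => x; rewrite -{1}[a]free_of_seqK -free_of_seq_cat -catA.
Qed.

Lemma sigma_continuous (X : topologicalType) : continuous (sigma : X -> Fq X).
Proof. exact: (free_of_seq_continuous X [::] [::] true). Qed.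

Section Extension.
Context (X : topologicalType) (G : preTopologicalGroupType) (f : X -> G).

Definition letter_value (a : letter X) : G :=
  if projT1 a then f (projT2 a) else (f (projT2 a))^-1.

Definition word_value (s : seq (letter X)) : G :=
  foldr (fun a g => letter_value a * g) 1 s.

Definition extension (u : Fq X) : G := word_value (sval u).

Lemma letter_value_inv a : letter_value (letter_inv a) = (letter_value a)^-1.
Proof. by case: a => -[] x; rewrite /letter_value //= invgK. Qed.

Lemma word_value_cat s t : word_value (s ++ t) = word_value s * word_value t.
Proof. by elim: s => [|a s IHs] /=; rewrite ?mul1g // IHs mulgA. Qed.

(** Since [a] and its formal inverse have inverse values, cancelling them does
not change the value; this is what makes evaluation well behaved on reduced
words. *)
Lemma word_value_push a s : word_value (push a s) = letter_value a * word_value s.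
Proof.
case: s => [|b s] //=; case: eqP => [->|//].
by rewrite letter_value_inv mulgA mulgV mul1g.
Qed.

Lemma word_value_reduce s : word_value (reduce s) = word_value s.
Proof. by elim: s => //= a s IHs; rewrite word_value_push IHs. Qed.

Lemma extensionM : {morph extension : u v / u * v >-> u * v}.
Proof.
by move=> u v; rewrite /extension Fq_mulE word_value_reduce word_value_cat.
Qed.

Lemma extension_sigma : extension \o sigma = f.
Proof. by apply/funext => x; rewrite /extension /= mulg1. Qed.

(** Seen from a single letter of a word, the extension is the value of that
letter between two constants: [f], possibly followed by inversion, and then two
translations of [G]. *)
Lemma extension_continuous :
  quasitopological_group G -> continuous f -> continuous extension.
Proof.
case=> cV cL cR cf; apply/Fq_continuousP => s t b.
have cb : continuous (fun x : X => letter_value (existT _ b x)).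
  by case: b => // x; apply: continuous_comp; [exact: cf|exact: cV].
rewrite (_ : (fun x => _) = (fun g => word_value s * (g * word_value t)) \o
    (fun x : X => letter_value (existT _ b x))); last first.
  by apply/funext => x; rewrite /extension word_value_reduce word_value_cat.
move=> x; apply: continuous_comp; first exact: cb.
by apply: (@continuous_comp _ _ _ (fun g => g * word_value t));
  [exact: cR|exact: cL].
Qed.

(** A morphism is determined by its values on the letters of a word, and its
value at [x^-1] is forced to be the inverse of its value at [x]. *)
Lemma extension_unique (h : Fq X -> G) :
  {morph h : u v / u * v >-> u * v} -> h \o sigma = f -> extension = h.
Proof.
move=> hM hf; apply/funext => u; rewrite -(free_of_seqK X u).
have h1 : h 1 = 1 by apply: (mulgI (h 1)); rewrite -hM !mulg1.
rewrite /extension word_value_reduce.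
elim: (sval u) => [|[b x] s IHs] /=; first by rewrite -h1.
rewrite -cat1s free_of_seq_cat hM IHs; congr (_ * _).
rewrite /letter_value -hf; case: b => //=.
apply: mulg1_eq; rewrite -hM -h1 -free_of_seq_cat; congr h.
by apply: val_inj; rewrite /= eqxx.
Qed.

End Extension.

Theorem theorem4p3 (X : topologicalType) :
  quasitopological_group (Fq X) /\
  continuous (sigma : X -> Fq X) /\
  (forall (G : preTopologicalGroupType) (f : X -> G),
     quasitopological_group G -> continuous f ->
     exists! fhat : Fq X -> G,
       [/\ continuous fhat,
           {morph fhat : u v / u * v >-> u * v}
         & fhat \o sigma = f]).
Proof.
split; first exact: Fq_quasitopological.
split; first exact: sigma_continuous.
move=> G f qG cf; exists (extension X G f); split.
  split; [exact: extension_continuous|exact: extensionM|exact: extension_sigma].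
by move=> h [_ hM hf]; exact: extension_unique.
Qed.
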